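(* Let $X=(V,E)$ be a regular connected graph with a nonempty set $S$ of marked vertices, and fix a marked vertex $a\in S$. (a) Suppose $X$ is bipartite. Fix a spanning tree $T$. Then the $(-1)$-eigenspace of $U$ has the $\{0,\pm1\}$-basis $\{z_e:e\in E\setminus E(T)\}\cup\{z_b:b\in S\setminus\{a\}\}$, where $z_e,z_b\in\mathbb{R}^{\text{arcs}(X)}$ are: (i) for $e\in E\setminus E(T)$, $z_e$ assigns $1$ and $-1$ alternately to the pairs of opposite arcs along the fundamental cycle containing $e$ relative to $T$ (both arcs of an edge receiving the same value), $0$ elsewhere; (ii) for $b\in S\setminus\{a\}$, $z_b$ assigns $1$ and $-1$ alternately to the pairs of opposite arcs along a path from $a$ to $b$, $0$ elsewhere. (b) Suppose $X$ is non-bipartite. Let $Y$ be a spanning subgraph of $X$ with $|V|$ edges and exactly one odd cycle (all other cycles absent). Then the $(-1)$-eigenspace of $U$ has the $\{0,\pm1,\pm2\}$-basis $\{z_e:e\in E\setminus E(Y)\}\cup\{z_b:b\in S\setminus\{a\}\}\cup\{z_a\}$, where (both arcs of an edge always receiving the same value, and $0$ on unmentioned arcs): (i) if $Y\cup\{e\}$ has an even cycle containing $e$, then $z_e$ assigns $1$ and $-1$ alternately to pairs of opposite arcs along this cycle; otherwise $Y\cup\{e\}$ contains two odd cycles joined by a path, one of which contains $e$, and $z_e$ assigns $2$ and $-2$ alternately to pairs of opposite arcs along this path and $1$ and $-1$ alternately to pairs of opposite arcs along the two odd cycles, so that for every vertex the values on its outgoing arcs sum to zero; (ii) for $b\in S\setminus\{a\}$,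 $z_b$ assigns $1$ and $-1$ alternately to pairs of opposite arcs along a path from $a$ to $b$; (iii) for a path joining $a$ to the odd cycle of $Y$, $z_a$ assigns $2$ and $-2$ alternately to pairs of opposite arcs along this path and then $1$ and $-1$ alternately to pairs of opposite arcs along the odd cycle, so that for every vertex other than $a$ the values on its outgoing arcs sum to zero.
   Context: $X$ is $k$-regular. An arc is an ordered pair $(u,v)$ of adjacent vertices ($u$ the tail). $R$ is the arc-reversal permutation matrix; $D_t$ is the $V\times\text{arcs}$ tail incidence matrix with $(D_t)_{x,(u,v)}=1$ iff $x=u$; $O_S$ is the identity matrix with its $[S,S]$ block zeroed. The transition matrix is $U=R\left(\frac{2}{k}D_t^TO_SD_t-I\right)$. *)

(* Defs.v *)
From mathcomp Require Import all_boot all_algebra.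
From mathcomp Require Import reals.

Set Implicit Arguments.
Unset Strict Implicit.
Unset Printing Implicit Defensive.

Import GRing.Theory.
Local Open Scope ring_scope.

Section Graphs.
Variable V : finType.
Implicit Types (g X Y T : rel V) (e : {set V}) (u v x y : V).

Definition simple_graph g : Prop := symmetric g /\ irreflexive g.

Definition regular g (k : nat) : Prop := forall v, #|[set w | g v w]| = k.

Definition connected g : Prop := forall u v, connect g u v.

Definition bipartite g : Prop :=
  exists A : {set V}, forall u v, g u v -> (u \in A) != (v \in A).

Definition edges g : {set {set V}} :=
  [set [set uv.1; uv.2] | uv : V * V & g uv.1 uv.2].

(* All graphs live on the whole vertex type, so every subgraph is spanning. *)
Definition spanning_subgraph Y X : Prop := symmetric Y /\ subrel Y X.

Definition add_edge Y e : rel V := [rel u v | Y u v || ([set u; v] == e)].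

(* The walk x :: p; a path is a walk without repeated vertices, possibly of
   length zero (p = [::]). *)
Definition walk_edges x (p : seq V) : seq {set V} :=
  pairmap (fun u v => [set u; v]) x p.

Definition is_path g x p y : Prop :=
  [/\ path g x p, uniq (x :: p) & last x p = y].

(* The cycle x :: p visits the vertices of x :: p in order and then returns
   to x; 2 < size (x :: p) excludes traversing one edge back and forth. *)
Definition is_cycle g x p : Prop :=
  [/\ (1 < size p)%N, cycle g (x :: p) & uniq (x :: p)].

Definition cycle_edges x p : seq {set V} := walk_edges x (rcons p x).

Definition odd_cycle g x p : Prop := is_cycle g x p /\ odd (size (x :: p)).

Definition even_cycle g x p : Prop := is_cycle g x p /\ ~~ odd (size (x :: p)).

Definition spanning_tree T X : Prop :=
  [/\ spanning_subgraph T X, connected T & forall x p, ~ is_cycle T x p].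

(* The vertex sequence of a cycle is only determined up to rotation and
   reversal, so uniqueness is uniqueness of its edge set. *)
Definition odd_unicyclic Y X : Prop :=
  [/\ spanning_subgraph Y X, #|edges Y| = #|V| &
      exists x p, odd_cycle Y x p /\
        forall x' p', is_cycle Y x' p' -> cycle_edges x' p' =i cycle_edges x p].

Definition meets_only_at (s t : seq V) x : Prop :=
  forall v, v \in s -> v \in t -> v = x.

(* Two odd cycles x :: p1 and y :: p2 joined by the path x :: q from x to y.
   The path may have length zero, in which case the cycles share exactly the
   vertex x = y; otherwise they are disjoint. *)
Definition joined_odd_cycles g x p1 y p2 q : Prop :=
  [/\ odd_cycle g x p1, odd_cycle g y p2, is_path g x q y &
   [/\ meets_only_at (x :: q) (x :: p1) x,
       meets_only_at (x :: q) (y :: p2) y,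
       meets_only_at (x :: p1) (y :: p2) x &
       meets_only_at (x :: p1) (y :: p2) y]].

End Graphs.

Definition graph_arc (V : finType) (X : rel V) := {uv : V * V | X uv.1 uv.2}.

Section Walk.
Variables (R : realType) (V : finType) (X : rel V).

Local Notation arcs := {: graph_arc X}.

Definition arc_tail (al : graph_arc X) : V := (val al).1.
Definition arc_head (al : graph_arc X) : V := (val al).2.
Definition arc_edge (al : graph_arc X) : {set V} :=
  [set arc_tail al; arc_head al].

(* Rows and columns are numbered through the enumerations of V and of the
   arcs. *)
Definition tail_mx : 'M[R]_(#|V|, #|arcs|) :=
  \matrix_(i, j) (enum_val i == arc_tail (enum_val j))%:R.

Definition reversal_mx : 'M[R]_#|arcs| :=
  \matrix_(i, j) ((arc_tail (enum_val i) == arc_head (enum_val j)) &&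
                  (arc_head (enum_val i) == arc_tail (enum_val j)))%:R.

Definition unmarked_mx (S : {set V}) : 'M[R]_#|V| :=
  \matrix_(i, j) (if (enum_val i \in S) && (enum_val j \in S) then 0
                  else (i == j)%:R).

Definition transition_mx (k : nat) (S : {set V}) : 'M[R]_#|arcs| :=
  reversal_mx *m
    ((2 / k%:R) *: (tail_mx^T *m unmarked_mx S *m tail_mx) - 1%:M).

Definition arc_vec := 'cV[R]_#|arcs|.

(* Eigenspace for the action on column vectors. *)
Definition mx_eigenspace (A : 'M[R]_#|arcs|) (lam : R) :
    {vspace 'cV[R]_#|arcs|} :=
  passmx.leigenspace (linfun (mulmx A)) lam.

Implicit Types (z : arc_vec) (e : {set V}).

Definition entry z (al : graph_arc X) : R := z (enum_rank al) 0.

Definition out_sum z (v : V) : R :=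
  \sum_(al : graph_arc X | arc_tail al == v) entry z al.

(* m and - m alternate along the edge sequence s, both arcs of an edge
   receiving the same value; the sign eps of the first edge is free. *)
Definition alternates z (m : R) (s : seq {set V}) : Prop :=
  exists eps : bool, forall (i : nat) (al : graph_arc X), (i < size s)%N ->
    arc_edge al = nth set0 s i -> entry z al = (-1) ^+ (eps + i) * m.

Definition zero_off z (s : seq {set V}) : Prop :=
  forall al : graph_arc X, arc_edge al \notin s -> entry z al = 0.

Definition along_path z (a b : V) : Prop :=
  exists p, [/\ is_path X a p b, alternates z 1 (walk_edges a p) &
                zero_off z (walk_edges a p)].

(* If T is a spanning tree, the fundamental cycle of e is the only cycle of
   T + e. *)
Definition along_fundamental_cycle (T : rel V) e z : Prop :=
  exists x p, [/\ is_cycle (add_edge T e) x p, e \in cycle_edges x p,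
    alternates z 1 (cycle_edges x p) & zero_off z (cycle_edges x p)].

Definition even_cycle_through (Y : rel V) e x p : Prop :=
  even_cycle (add_edge Y e) x p /\ e \in cycle_edges x p.

Definition along_even_cycle (Y : rel V) e z : Prop :=
  exists x p, [/\ even_cycle_through Y e x p,
    alternates z 1 (cycle_edges x p) & zero_off z (cycle_edges x p)].

Definition along_joined_odd_cycles (Y : rel V) e z : Prop :=
  exists x p1 y p2 q,
    [/\ joined_odd_cycles (add_edge Y e) x p1 y p2 q,
        e \in cycle_edges x p1 \/ e \in cycle_edges y p2,
        [/\ alternates z 2 (walk_edges x q),
            alternates z 1 (cycle_edges x p1) &
            alternates z 1 (cycle_edges y p2)],
        zero_off z (walk_edges x q ++ cycle_edges x p1 ++ cycle_edges y p2) &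
        forall v, out_sum z v = 0].

Definition nonbip_edge_vec (Y : rel V) e z : Prop :=
  ((exists x p, even_cycle_through Y e x p) -> along_even_cycle Y e z) /\
  (~ (exists x p, even_cycle_through Y e x p) -> along_joined_odd_cycles Y e z).

(* The path from a reaches the odd cycle y :: p of Y at y; it has length zero
   if a lies on that cycle. *)
Definition along_path_to_odd_cycle (Y : rel V) (a : V) z : Prop :=
  exists q y p,
    [/\ is_path X a q y /\ odd_cycle Y y p,
        meets_only_at (a :: q) (y :: p) y,
        alternates z 2 (walk_edges a q) /\ alternates z 1 (cycle_edges y p),
        zero_off z (walk_edges a q ++ cycle_edges y p) &
        forall v, v != a -> out_sum z v = 0].

(* B is a basis of W, as an indexed family, all of whose vectors have their
   entries in vals. *)
Definition basis_with_entries (vals : seq R) (W : {vspace 'cV[R]_#|arcs|})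
    (B : seq arc_vec) : Prop :=
  basis_of W B /\ forall z, z \in B -> forall al, entry z al \in vals.

End Walk.

(* Main.v *)
Require Import Defs.
From HB Require Import structures.
From mathcomp Require Import all_boot all_algebra.
From mathcomp Require Import boolp reals ring.

(* The eigenvalue equation U z = -z says that z takes the same value on opposite
   arcs and that its out-sums vanish off S, so the (-1)-eigenspace consists of
   edge weightings with prescribed vertex sums. The weights z_b, z_a are detected
   by their out-sums at b and a, and z_e by its value on e, in triangular fashion,
   which gives independence. For spanning, subtracting a combination of them
   leaves a weighting supported on T (or Y) whose vertex sums vanish except
   possibly at a (or everywhere). On an acyclic support such a weighting is zero,
   because a forest with an edge has two leaves; on the odd unicyclic Y one first
   subtracts a multiple of the alternating weighting of the odd cycle.

   The joined odd cycles exist because a path of Y meeting the odd cycle in two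
   vertices could be rerouted along the arc of either parity, closing up with e to
   an even cycle. *)

Set Implicit Arguments.
Unset Strict Implicit.
Unset Printing Implicit Defensive.

Import GRing.Theory Num.Theory.
Local Open Scope ring_scope.

#[local] Arguments walk_edges : simpl never.

(** * Edges of walks and cycles *)

Section Paths.
Variable V : finType.
Implicit Types (g : rel V) (x y u v : V) (p : seq V) (C : pred V).

Lemma edge_eqP u v x y :
  reflect (u = x /\ v = y \/ u = y /\ v = x) ([set u; v] == [set x; y]).
Proof.
apply: (iffP eqP) => [E|[[-> ->]|[-> ->]]] //; last by rewrite setUC.
have : u \in [set x; y] by rewrite -E set21.
have : v \in [set x; y] by rewrite -E set22.
have : x \in [set u; v] by rewrite E set21.
have : y \in [set u; v] by rewrite E set22.
rewrite !inE => /orP[]/eqP H1 /orP[]/eqP H2 /orP[]/eqP H3 /orP[]/eqP H4.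
all: subst; auto.
Qed.

Lemma mem_edges g u v : symmetric g -> ([set u; v] \in edges g) = g u v.
Proof.
move=> gS; apply/imsetP/idP => [[[x y]] /=|guv]; last by exists (u, v); rewrite ?inE.
by rewrite inE /= => gxy /eqP/edge_eqP[[-> ->]|[-> ->]] //; rewrite gS.
Qed.

Lemma edgesP g e : reflect (exists u v, g u v /\ e = [set u; v]) (e \in edges g).
Proof.
apply: (iffP imsetP) => [[[x y]]|[u [v [guv ->]]]]; last by exists (u, v); rewrite ?inE.
by rewrite inE /= => gxy ->; exists x, y.
Qed.

Lemma walk_edges_cons x y p :
  walk_edges x (y :: p) = [set x; y] :: walk_edges y p.
Proof. by []. Qed.

Lemma walk_edges_cat x p q :
  walk_edges x (p ++ q) = walk_edges x p ++ walk_edges (last x p) q.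
Proof. exact: pairmap_cat. Qed.

Lemma size_walk_edges x p : size (walk_edges x p) = size p.
Proof. exact: size_pairmap. Qed.

Lemma walk_edges_sub x p e v :
  e \in walk_edges x p -> v \in e -> v \in x :: p.
Proof.
elim: p x => //= y p IH x; rewrite walk_edges_cons inE => /predU1P[->|/IH H /H].
  by rewrite !inE => /orP[] ->; rewrite ?orbT.
by rewrite !inE => ->; rewrite orbT.
Qed.

Lemma walk_edges_path g x p e : path g x p -> e \in walk_edges x p -> e \in edges g.
Proof.
elim: p x => //= y p IH x /andP[gxy /IH H]; rewrite walk_edges_cons inE.
by case/predU1P=> [->|/H //]; apply/edgesP; exists x, y.
Qed.

Lemma uniq_walk_edges x p : uniq (x :: p) -> uniq (walk_edges x p).
Proof.
elim: p x => //= y p IH x /andP[xp up]; rewrite IH // andbT.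
by apply: contra xp => /walk_edges_sub; apply; rewrite set21.
Qed.

Lemma uniq_cycle_edges x p :
  (1 < size p)%N -> uniq (x :: p) -> uniq (cycle_edges x p).
Proof.
move=> sp up; rewrite /cycle_edges -cats1 walk_edges_cat cats1 rcons_uniq.
rewrite uniq_walk_edges // andbT.
case: p sp up => // y p; rewrite walk_edges_cons inE => sp /andP[xp up].
apply/norP; split; last first.
  by apply: contra xp => /walk_edges_sub; apply; rewrite set22.
apply/edge_eqP => -[[E _]|[E _]]; first by rewrite -E /= mem_last in xp.
case: p sp up E {xp} => //= z p _ /andP[yp _] E.
by rewrite -E /= mem_last in yp.
Qed.

Lemma cycle_edges_edges g x p e :
  cycle g (x :: p) -> e \in cycle_edges x p -> e \in edges g.
Proof. exact: walk_edges_path. Qed.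

Lemma cycle_edges_sub x p e v :
  e \in cycle_edges x p -> v \in e -> v \in x :: p.
Proof.
by move=> ep /(walk_edges_sub ep); rewrite !inE mem_rcons inE orbA orbb.
Qed.

Lemma cycle_restrict g g' x p :
  (forall u v, u \in x :: p -> v \in x :: p -> [set u; v] \in cycle_edges x p ->
     g u v -> g' u v) ->
  cycle g (x :: p) -> cycle g' (x :: p).
Proof.
rewrite /cycle_edges /= => H.
have {H}: forall u v, [set u; v] \in walk_edges x (rcons p x) -> g u v -> g' u v.
  by move=> u v uv; apply: H => //; apply: (cycle_edges_sub uv); rewrite ?set21 ?set22.
move: (rcons p x) => q; elim: q x => //= y q IH x H /andP[gxy gq].
rewrite H ?walk_edges_cons ?mem_head //=; apply: IH gq => u v uv; apply: H.
by rewrite walk_edges_cons inE uv orbT.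
Qed.

Lemma is_cycle_sub g g' x p : subrel g g' -> is_cycle g x p -> is_cycle g' x p.
Proof.
by move=> sgg [sp cp up]; split=> //; apply: cycle_restrict cp => u v _ _ _ /sgg.
Qed.

Lemma cycle_rotate g x p y : is_cycle g x p -> y \in x :: p ->
  exists q, [/\ is_cycle g y q, perm_eq (x :: p) (y :: q) &
                cycle_edges x p =i cycle_edges y q].
Proof.
move=> cp; rewrite inE => /predU1P[->|/splitPr yp]; first by exists p.
case: yp cp => p1 p2 [sp cp up]; exists (p2 ++ x :: p1).
have R : rot (size (x :: p1)) (x :: p1 ++ y :: p2) = y :: p2 ++ x :: p1.
  by rewrite -cat_cons rot_size_cat.
split.
- split; last by rewrite -R rot_uniq.
    by move: sp; rewrite !size_cat /= !addnS addnC.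
  by rewrite -R rot_cycle.
- by rewrite perm_sym -R perm_rot.
move=> e; rewrite /cycle_edges.
rewrite -[p1 ++ _]cat_rcons rcons_cat walk_edges_cat last_rcons.
rewrite -[p2 ++ _]cat_rcons rcons_cat walk_edges_cat last_rcons.
by rewrite !mem_cat orbC.
Qed.

(** * Leaves of acyclic graphs *)

(** A path ending at [x] can always be prolonged at its front [y]: besides its successor, [y] has
    another neighbour [w], and [w] cannot lie on the path, because the graph has neither loops nor
    cycles. *)
Lemma acyclic_path_grow g x u n :
  symmetric g -> irreflexive g -> (forall x p, ~ is_cycle g x p) ->
  g x u -> (forall v w, v != x -> g v w -> exists2 w', w' != w & g v w') ->
  exists y p, [/\ path g y p, uniq (y :: p), last y p = x & size p = n.+1].
Proof.
move=> gS gI noC gxu two; elim: n => [|n [y [p [pp up lp sp]]]].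
  exists u, [:: x]; split=> //=; first by rewrite gS gxu.
  by rewrite inE andbT; apply: contraTneq gxu => ->; rewrite gI.
case: p pp up lp sp => // y' p /= /andP[gyy' pp] /andP[yp up] lp [sp].
have yx : y != x by apply: contraNneq yp => ->; rewrite -lp mem_last.
have [w wy' gyw] := two y y' yx gyy'.
exists w, [:: y, y' & p]; split=> //=; rewrite ?sp ?yp ?up ?pp ?gyy' ?(gS w) ?gyw //.
rewrite !andbT; apply/negP; rewrite !inE (negPf wy') => /or3P[/eqP E|//|wp].
  by rewrite E gI in gyw.
(* If [w] were further along the path, the segment from [y] to [w] and the edge back would form a
   cycle, with at least three vertices because [w] differs from [y']. *)
case/splitPr: wp pp yp up {sp lp} => p1 p2 pp yp up.
apply: (noC y (y' :: rcons p1 w)); split=> //=; first by rewrite size_rcons.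
  move: pp; rewrite gyy' -cat_rcons cat_path => /andP[pp _].
  by rewrite rcons_path pp last_rcons gS gyw.
move: yp up; rewrite -cat_rcons !inE !mem_cat !negb_or cat_uniq => /and3P[-> -> _] /=.
by case/andP=> /andP[-> _] /and3P[-> _ _].
Qed.

(** Growing a path beyond the number of vertices is absurd. Growing towards [a] therefore shows that
    [a] is isolated; then no vertex is exceptional, and growing towards the end of any edge is
    absurd as well. *)
Lemma acyclic_exceptional_leaf g a :
  symmetric g -> irreflexive g -> (forall x p, ~ is_cycle g x p) ->
  (forall v w, v != a -> g v w -> exists2 w', w' != w & g v w') ->
  forall u v, ~~ g u v.
Proof.
move=> gS gI noC two.
have grow x u : g x u ->
    (forall v w, v != x -> g v w -> exists2 w', w' != w & g v w') -> False.
  move=> gxu H; have [y [p [_ up _ sp]]] := acyclic_path_grow #|V| gS gI noC gxu H.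
  have /card_uniqP := up; have := max_card [in y :: p]; rewrite /= sp => + E.
  by rewrite E -addn2 -[X in (_ <= X)%N]addn0 leq_add2l.
have isol w : ~~ g a w by apply/negP => /grow; apply.
move=> u v; apply/negP => /grow; apply=> y w _ gyw; apply: two (gyw).
by apply: contraTneq gyw => ->; apply: isol.
Qed.

(** * Paths meeting cycles *)

Lemma first_hit C x p : has C (x :: p) ->
  exists p1 p2, [/\ p = p1 ++ p2, C (last x p1) &
    forall v, v \in x :: p1 -> C v -> v = last x p1].
Proof.
elim: p x => [|y p IH] x /=; first by rewrite orbF; exists [::], [::]; split=> // v; rewrite inE => /eqP.
have [Cx _|Cx /= /IH [p1 [p2 [-> Cl H]]]] := boolP (C x).
  by exists [::], (y :: p); split=> // v; rewrite inE => /eqP.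
exists (y :: p1), p2; split=> // v; rewrite inE => /predU1P[->|/H //].
by rewrite (negPf Cx).
Qed.

Lemma last_hit C x p : has C (x :: p) ->
  exists p1 p2, [/\ p = p1 ++ p2, C (last x p1) & ~~ has C p2].
Proof.
elim: p x => [|y p IH] x /=; first by rewrite orbF; exists [::], [::].
have [hp _|hp] := boolP (has C (y :: p)).
  by have [p1 [p2 [-> Cl H]]] := IH y hp; exists (y :: p1), p2.
have := hp; rewrite /= => /negPf->; rewrite orbF => Cx.
by exists [::], (y :: p).
Qed.

Lemma is_path_nil g x p : is_path g x p x -> p = [::].
Proof.
case: p => // y p [_ /= /andP[xp _]] E.
by rewrite -E mem_last in xp.
Qed.

Lemma connect_is_path g x y : connect g x y -> exists p, is_path g x p y.
Proof. by case/connectP=> p pp ->; case/shortenP: pp => q qq uq _; exists q. Qed.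

(** Start a path from [x] to [y] at its last vertex in [A], then stop at the first vertex in [B] of
    what remains. *)
Lemma is_path_between g (A B : pred V) x y : connect g x y -> A x -> B y ->
  exists x' y' p, [/\ A x', B y', is_path g x' p y',
    forall v, v \in x' :: p -> A v -> v = x' &
    forall v, v \in x' :: p -> B v -> v = y'].
Proof.
move=> /connect_is_path[p [pp up lp]] Ax By.
have [|p1 [p2 [Ep Al p2A]]] := @last_hit A x p; first by rewrite /= Ax.
move: pp up lp; rewrite Ep cat_path last_cat -cat_cons cat_uniq.
set x' := last x p1 in Al * => /andP[_ pp2] /and3P[_ dis up2] lp.
have ux' : uniq (x' :: p2).
  rewrite /= up2 andbT; apply: contra dis => xp2; apply/hasP.
  by exists x' => //; rewrite mem_last.
have [|p3 [p4 [Ep2 Bl H]]] := @first_hit B x' p2.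
  by apply/hasP; exists y => //; rewrite -lp mem_last.
exists x', (last x' p3), p3; split=> //.
  split=> //; first by move: pp2; rewrite Ep2 cat_path => /andP[].
  by move: ux'; rewrite Ep2 -cat_cons cat_uniq => /andP[].
move=> v; rewrite inE => /predU1P[//|vp3] Av.
by case/hasP: p2A; exists v => //; rewrite Ep2 mem_cat vp3.
Qed.

(** The two arcs of the cycle between [u] and [v] have lengths adding up to an odd number, so one of
    them has the required parity. *)
Lemma odd_cycle_arc g x p u v (b : bool) : symmetric g ->
  odd_cycle g x p -> u \in x :: p -> v \in x :: p -> u != v ->
  exists q, [/\ is_path g u q v, {subset q <= x :: p} & odd (size q) = b].
Proof.
move=> gS [cp op] ux vx uv.
have [q [[sq cq uq] perm _]] := cycle_rotate cp ux.
rewrite (perm_size perm) in op; have sub := perm_mem perm.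
have vq : v \in q.
  by move: vx; rewrite sub inE eq_sym (negPf uv).
case/splitPr: vq cq uq op sub {sq perm} => q1 q2 cq uq op sub.
move: cq; rewrite /= -cat_rcons -cats1 -catA cat_path last_rcons cats1.
case/andP=> pq1 pq2.
have arc1 : is_path g u (rcons q1 v) v.
  split; rewrite ?last_rcons //.
  by move: uq; rewrite -cat_rcons -cat_cons cat_uniq => /andP[].
have arc2 : is_path g u (rcons (rev q2) v) v.
  split; rewrite ?last_rcons //.
    have := rev_path g v (rcons q2 u); rewrite last_rcons belast_rcons rev_cons.
    by move=> ->; rewrite (eq_path (e' := g)) // => s t; rewrite gS.
  move: uq; rewrite /= mem_cat inE mem_rcons inE mem_rev !negb_or.
  rewrite cat_uniq /= rcons_uniq mem_rev rev_uniq.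
  by case/andP=> /and3P[_ -> ->] /and3P[_ _ /andP[-> ->]].
have par : odd (size (rcons q1 v)) (+) odd (size (rcons (rev q2) v)).
  by move: op; rewrite /= size_cat /= !size_rcons size_rev /= oddD /=; do 2!case: odd.
have [E|E] := eqVneq (odd (size (rcons q1 v))) b.
  exists (rcons q1 v); split=> // w; rewrite mem_rcons inE sub inE mem_cat inE.
  by case/orP=> ->; rewrite ?orbT.
exists (rcons (rev q2) v); split=> //.
  move=> w; rewrite mem_rcons inE mem_rev sub inE mem_cat inE.
  by case/orP=> ->; rewrite ?orbT.
by move: par E; do 2!case: odd; case: b.
Qed.

Lemma close_cycle g u v p : symmetric g -> is_path g u p v -> u != v -> ~~ g u v ->
  is_cycle (add_edge g [set u; v]) u p /\ [set u; v] \in cycle_edges u p.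
Proof.
move=> gS [pp up lp] uv guv; split; last first.
  by rewrite /cycle_edges -cats1 walk_edges_cat mem_cat lp /= mem_seq1 setUC eqxx orbT.
split=> //.
  (* Lengths zero and one are excluded by [u != v] and by non-adjacency, so the closed path is a
     genuine cycle. *)
  case: p pp lp {up} => [|w [|? ?]] //= pp lp; first by rewrite lp eqxx in uv.
  by rewrite andbT lp (negPf guv) in pp.
rewrite /= rcons_path lp; apply/andP; split; last by apply/orP; right; apply/edge_eqP; right.
by apply: sub_path pp => s t gst; apply/orP; left.
Qed.

(** Let [u'] and [v'] be the first and the last vertex of the path on the cycle. If they differ, the
    piece between them is exchanged for an arc of the cycle; only [u'] and [v'] are shared with the
    rest of the path, so the result is again a path. *)
Lemma path_meets_odd_cycle_once g x p u v q : symmetric g ->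
  odd_cycle g x p -> is_path g u q v -> u != v -> ~~ g u v ->
  ~ (exists y r, even_cycle_through g [set u; v] y r) ->
  forall s t, s \in x :: p -> t \in x :: p -> s \in u :: q -> t \in u :: q -> s = t.
Proof.
move=> gS oC [pq uq lq] uv guv noE.
have [hC|/hasPn hC] := boolP (has [in x :: p] (u :: q)); last first.
  by move=> s t sC _ /hC; rewrite /= sC.
have [q1 [q2 [Eq Cl H1]]] := first_hit hC.
set u' := last u q1 in Cl H1.
have [|q3 [q4 [Eq2 Cl2 /hasPn H2]]] := @last_hit [in x :: p] u' q2.
  by rewrite /= Cl.
set v' := last u' q3 in Cl2.
move: pq uq lq; rewrite Eq Eq2 !cat_path !last_cat -/u' -/v' => /and3P[pp1 pp3 pp4].
rewrite -cat_cons cat_uniq => /and3P[up1 d134 up34] lq.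
(* If both meeting vertices coincide, the middle piece [q3] is empty and [u'] is the only vertex on
   the cycle. *)
have [E|u'v'] := eqVneq u' v'.
  have q3n : q3 = [::].
    apply: (is_path_nil (g := g) (x := u')); split=> //=.
    move: up34; rewrite cat_uniq => /andP[-> _]; rewrite andbT.
    apply: contra d134 => u'q3; apply/hasP; exists u'; first by rewrite mem_cat u'q3.
    exact: mem_last.
  suff K s : s \in x :: p -> s \in u :: q1 ++ q2 -> s = u'.
    by rewrite -Eq2 => s t sC tC /(K _ sC)-> /(K _ tC)->.
  move=> sC; rewrite -cat_cons mem_cat => /orP[/H1->//|].
  by rewrite Eq2 q3n /= => /H2; rewrite /= sC.
(* This parity makes the rerouted path from [u] to [v] odd in length, so that closing it with the
   new edge gives an even cycle. *)
have [r [[pr ur lr] rC or]] :=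
  odd_cycle_arc (~~ odd (size q1 + size q4)) gS oC Cl Cl2 u'v'.
case: noE; exists u, (q1 ++ r ++ q4).
have [|//||c ce] := @close_cycle g u v (q1 ++ r ++ q4) gS; last first.
- split=> //; split=> //; rewrite /= !size_cat addnCA oddD or.
  by rewrite addbC addbN addbb.
- done.
split; rewrite ?cat_path ?last_cat ?lr -/u' ?pp1 ?pr //.
rewrite -cat_cons cat_uniq up1 cat_uniq /= has_cat negb_or.
move: d134; rewrite has_cat negb_or => /andP[_ ->].
move: up34; rewrite cat_uniq => /and3P[_ _ ->].
move: ur; rewrite /= => /andP[u'r ->]; rewrite !andbT /=.
apply/andP; split; apply/hasPn => s.
  move=> sr; apply/negP => /H1 E; move: u'r; rewrite -E ?sr //; exact: rC.
by move=> /H2; apply: contra => /rC.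
Qed.

(** A path from [u] to [v] closes with the new edge to a cycle, odd because no even one exists, and
    this cycle meets the old odd cycle in at most one vertex. If it meets it, the joining path is
    trivial; otherwise a path of [g] between the two cycles is trimmed at both ends. *)
Lemma joined_odd_cycles_through g x p u v : symmetric g -> irreflexive g ->
  (forall s t, connect g s t) -> odd_cycle g x p -> u != v -> ~~ g u v ->
  ~ (exists y r, even_cycle_through g [set u; v] y r) ->
  exists x' p1 y p2 q,
    joined_odd_cycles (add_edge g [set u; v]) x' p1 y p2 q /\
    [set u; v] \in cycle_edges x' p1.
Proof.
move=> gS gI gC oC uv guv noE.
have [r ruv] := connect_is_path (gC u v).
have one := path_meets_odd_cycle_once gS oC ruv uv guv noE.
have [c1 e1] := close_cycle gS ruv uv guv.
have gg' : subrel g (add_edge g [set u; v]) by move=> s t gst; apply/orP; left.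
have o1 : odd (size (u :: r)).
  by apply: contra_notT noE => o1; exists u, r.
(* The final implication says that meeting cycles are joined by a path of length zero; it yields the
   last two conditions of [joined_odd_cycles]. *)
have [x' [y [q [x'r yC q' qA [qB dj]]]]] : exists x' y q, [/\ x' \in u :: r, y \in x :: p,
   is_path g x' q y, meets_only_at (x' :: q) (u :: r) x' &
     meets_only_at (x' :: q) (x :: p) y /\
     ((exists2 s, s \in x :: p & s \in u :: r) -> x' = y)].
  have [/hasP[s sC sr]|/hasPn dj] := boolP (has [in u :: r] (x :: p)).
    exists s, s, [::]; split=> //; first by move=> w; rewrite inE => /eqP.
    by split=> // w; rewrite inE => /eqP.
  have [x' [y [q [? ? ? ? ?]]]] := is_path_between (A := [in u :: r])
     (B := [in x :: p]) (gC u x) (mem_head _ _) (mem_head _ _).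
  exists x', y, q; split=> //; split=> // -[s sC sr].
  by have := dj s sC; rewrite /= sr.
have [p1 [cp1 perm1 ee1]] := cycle_rotate c1 x'r.
have [p2 [cp2 perm2 ee2]] := cycle_rotate (is_cycle_sub gg' oC.1) yC.
exists x', p1, y, p2, q; split; last by rewrite -ee1.
have m1 := perm_mem perm1; have m2 := perm_mem perm2.
have dj1 s : s \in x' :: p1 -> s \in y :: p2 -> s = x' /\ s = y.
  rewrite -m1 -m2 => sr sC.
  have E := dj (ex_intro2 _ _ s sC sr); split; first by apply: one => //; rewrite E.
  by apply: one => //; rewrite -E.
split; [split=> //|split=> //|..].
- by rewrite -(perm_size perm1).
- by rewrite -(perm_size perm2); case: oC.
- by case: q' => pq uq lq; split=> //; apply: sub_path pq.
split=> [s|s|s|s]; rewrite -?m1 -?m2; [exact: qA|exact: qB|..]; rewrite m1 m2 => s1 s2.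
  by case: (dj1 s s1 s2).
by case: (dj1 s s1 s2).
Qed.

Lemma bipartite_cycle_even g x p : bipartite g -> is_cycle g x p ->
  ~~ odd (size (x :: p)).
Proof.
move=> [A HA] [_ + _]; rewrite -[size _](size_rcons p x) /cycle.
have: last x (rcons p x) = x by rewrite last_rcons.
move: (rcons p x) => q E gq.
suff: odd (size q) = (x \in A) (+) (last x q \in A) by rewrite E addbb => ->.
elim: q x gq {E} => [|y q IH] x /=; first by rewrite addbb.
by case/andP=> /HA + /IH ->; do 3!case: (_ \in A).
Qed.

End Paths.

(** * Alternating edge weightings *)

Section AlternatingSums.
Variables (R : numFieldType) (V : finType).
Implicit Types (g : rel V) (x y u v : V) (p : seq V) (w : V -> V -> R).

(** Signs accumulate on an edge that is traversed repeatedly, so that vertex sums telescope along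
    every walk. A cycle is treated as the closed walk [rcons p x]. *)
Fixpoint alt x p u v : R :=
  if p is y :: p' then ([set u; v] == [set x; y])%:R - alt y p' u v else 0.

Lemma alt_edge x p u v u' v' : [set u; v] = [set u'; v'] ->
  alt x p u v = alt x p u' v'.
Proof. by move=> E; elim: p x => //= y p IH x; rewrite E IH. Qed.

Lemma altC x p u v : alt x p u v = alt x p v u.
Proof. by apply: alt_edge; rewrite setUC. Qed.

Lemma alt_off x p u v : [set u; v] \notin walk_edges x p -> alt x p u v = 0.
Proof.
elim: p x => //= y p IH x; rewrite walk_edges_cons inE => /norP[/negPf-> /IH->].
by rewrite subr0.
Qed.

Lemma alt_nth x p u v i : uniq (walk_edges x p) -> (i < size p)%N ->
  [set u; v] = nth set0 (walk_edges x p) i -> alt x p u v = (-1) ^+ i.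
Proof.
elim: p x i => //= y p IH x [|i]; rewrite walk_edges_cons /= => /andP[xy up] ip E.
  by rewrite E eqxx alt_off ?subr0 // E.
rewrite (IH y i) // exprS mulN1r E; case: eqP => [E'|]; last by rewrite sub0r.
by rewrite -E' mem_nth ?size_walk_edges in xy.
Qed.

Lemma alt_support g x p u v : symmetric g -> path g x p -> alt x p u v != 0 -> g u v.
Proof.
move=> gS pp; apply: contraR => guv; rewrite alt_off //.
by apply: contra guv => /(walk_edges_path pp); rewrite mem_edges.
Qed.

Lemma sum_edge x y v : x != y ->
  \sum_u ([set v; u] == [set x; y])%:R = (v == x)%:R + (v == y)%:R :> R.
Proof.
move=> xy.
have E u : ([set v; u] == [set x; y])%:R =
    (v == x)%:R * (u == y)%:R + (v == y)%:R * (u == x)%:R :> R.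
  have [->|vx] := eqVneq v x.
    rewrite (negPf xy) mul0r addr0 mul1r; congr (nat_of_bool _)%:R.
    apply/edge_eqP/eqP => [[[]|[E]]|->]; [by []|by rewrite E eqxx in xy|by left].
  rewrite mul0r add0r -natrM mulnb; congr (nat_of_bool _)%:R.
  apply/edge_eqP/andP => [[[E]|[-> ->]]|[/eqP-> /eqP->]] //; last by right.
  by rewrite E eqxx in vx.
have S1 z : \sum_u (u == z)%:R = 1 :> R.
  by rewrite (bigD1 z) //= eqxx big1 ?addr0 // => i /negPf->.
by rewrite (eq_bigr _ (fun u _ => E u)) big_split -!mulr_sumr /= !S1 !mulr1.
Qed.

(** Consecutive edges contribute opposite signs at their common vertex, so only the two ends
    survive. A closed walk leaves 2 at its base point if its length is odd and 0 if it is even. *)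
Lemma sum_alt g x p v : irreflexive g -> path g x p ->
  \sum_u alt x p v u = (v == x)%:R - (-1) ^+ size p * (v == last x p)%:R.
Proof.
move=> gI; elim: p x => [|y p IH] x /=.
  by rewrite big1 // expr0 mul1r subrr.
case/andP=> gxy pp; rewrite sumrB (IH y pp) sum_edge; last first.
  by apply: contraTneq gxy => ->; rewrite gI.
by rewrite exprS mulN1r mulNr opprB opprK addrACA -addrA subrr addr0.
Qed.

(** In the support of [w] no vertex other than [a] can be a leaf, since its vertex sum would be a
    single nonzero weight; an acyclic support is then empty. *)
Lemma acyclic_kernel g a w : irreflexive g ->
  (forall x p, ~ is_cycle g x p) -> (forall u v, w u v = w v u) ->
  (forall u v, w u v != 0 -> g u v) -> (forall v, v != a -> \sum_u w v u = 0) ->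
  forall u v, w u v = 0.
Proof.
move=> gI noC wC wg w0.
pose h := [rel u v | w u v != 0].
have hS : symmetric h by move=> u v; rewrite /= wC.
have hI : irreflexive h.
  by move=> u; apply: contraFF (gI u); apply: wg.
have hC x p : ~ is_cycle h x p.
  by move=> c; apply: (noC x p); apply: is_cycle_sub c => s t /= /wg.
move=> u v; apply/eqP/negPn; apply: (acyclic_exceptional_leaf (a := a) hS hI hC).
move=> s t sa /= wst.
have [/existsP[t' /andP[]]|/existsPn H] := boolP [exists t', (t' != t) && (w s t' != 0)].
  by exists t'.
have := w0 s sa; rewrite (bigD1 t) //= big1 ?addr0; first by move/eqP; rewrite (negPf wst).
by move=> t' tt'; apply/eqP; have := H t'; rewrite tt' /= negbK.
Qed.

(* Subtracting a multiple of the alternating vector of the odd cycle kills one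
   edge of the cycle, at the price of a single exceptional vertex x. *)
Lemma odd_unicyclic_kernel g x p w : irreflexive g -> symmetric g -> odd_cycle g x p ->
  (forall x' p', is_cycle g x' p' -> cycle_edges x' p' =i cycle_edges x p) ->
  (forall u v, w u v = w v u) ->
  (forall u v, w u v != 0 -> g u v) -> (forall v, \sum_u w v u = 0) ->
  forall u v, w u v = 0.
Proof.
move=> gI gS [[sp cp up] op] one wC wg w0.
have ue := uniq_cycle_edges sp up.
case: p sp cp up op one ue => // y p sp cp up op one ue.
set c := alt x (rcons (y :: p) x).
have c1 : c x y = 1 by rewrite /c (alt_nth (i := 0)).
pose w' u v := w u v - w x y * c u v.
pose h := [rel u v | g u v && ([set u; v] != [set x; y])].
have w'0 u v : w' u v = 0.
  apply: (@acyclic_kernel h x) u v.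
  - by move=> u; rewrite /= gI.
  - move=> x' p' c'.
    (* A cycle of [h] is a cycle of [g], so it would have to contain the edge that [h] omits. *)
    have /one/(_ [set x; y]) : is_cycle g x' p'.
      by apply: is_cycle_sub c' => s t /andP[].
    case: c' => _ cc _; rewrite mem_head => /(cycle_edges_edges cc)/edgesP.
    by case=> s [t [/andP[_ /eqP H] E]]; rewrite E in H.
  - by move=> u v; rewrite /w' wC /c altC.
  - move=> u v w'uv; apply/andP; split; last first.
      apply: contraNneq w'uv => E; rewrite /w' /c (alt_edge _ _ E) -/c c1 mulr1.
      by case/eqP/edge_eqP: E => [[-> ->]|[-> ->]]; rewrite 1?(wC y) subrr.
    apply: contraR w'uv => guv; rewrite /w'.
    have -> : w u v = 0 by apply: contraNeq guv => /wg.
    have -> : c u v = 0 by apply: contraNeq guv; apply: alt_support.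
    by rewrite mulr0 subr0.
  move=> v vx; rewrite sumrB w0 -mulr_sumr (sum_alt _ gI cp) last_rcons.
  by rewrite (negPf vx) mulr0 subr0 mulr0 subr0.
(* The odd closed walk has vertex sum 2 at [x], so the sum of [w'] there is [- 2 * w x y], which
   must vanish. *)
have wxy : w x y = 0.
  have : \sum_u w' x u = 0 by apply: big1 => u _.
  rewrite sumrB w0 -mulr_sumr (sum_alt _ gI cp) last_rcons eqxx size_rcons.
  rewrite -signr_odd op expr1 mulN1r opprK sub0r => /eqP.
  by rewrite oppr_eq0 mulf_eq0 -mulr2n pnatr_eq0 orbF => /eqP.
by move=> u v; have := w'0 u v; rewrite /w' wxy mul0r subr0.
Qed.

(* The incidence map of the |V| edges is injective, hence onto. A preimage of
   the indicator of u, restricted to the component of u, shows that this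
   component contains the odd cycle. *)
Lemma odd_unicyclic_connected g x p : irreflexive g -> symmetric g ->
  #|edges g| = #|V| -> odd_cycle g x p ->
  (forall x' p', is_cycle g x' p' -> cycle_edges x' p' =i cycle_edges x p) ->
  forall u v, connect g u v.
Proof.
move=> gI gS eV oC one.
pose M : 'M[R]_(#|edges g|, #|V|) := \matrix_(i, j) ((enum_val j : V) \in (enum_val i : {set V}))%:R.
pose wt (r : 'rV[R]_#|edges g|) u v : R :=
  \sum_i r 0 i * (enum_val i == [set u; v])%:R.
have wtC r u v : wt r u v = wt r v u by rewrite /wt setUC.
have wtg r u v : wt r u v != 0 -> g u v.
  apply: contraR => guv; rewrite /wt big1 // => i _.
  case: eqP => [E|_]; last by rewrite mulr0.
  by move: (enum_valP i) guv; rewrite E mem_edges // => ->.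
have wts r v : \sum_u wt r v u = (r *m M) 0 (enum_rank v).
  rewrite exchange_big mxE /=; apply: eq_bigr => i _; rewrite mxE enum_rankK -mulr_sumr.
  congr (_ * _); have /edgesP[s [t [gst ->]]] := enum_valP i.
  have st : s != t by apply: contraTneq gst => ->; rewrite gI.
  under eq_bigr do rewrite eq_sym; rewrite sum_edge // !inE -natrD; congr _%:R.
  by have [->|] := eqVneq v s; rewrite ?(negPf st).
have Minj : row_free M.
  apply: inj_row_free => r rM; apply/rowP => i; rewrite mxE.
  have /edgesP[s [t [gst E]]] := enum_valP i.
  have := odd_unicyclic_kernel gI gS oC one (wtC r) (@wtg r).
  move=> /(_ _ s t) <-; last by move=> v; rewrite wts rM mxE.
  rewrite /wt (bigD1 i) //= E eqxx mulr1 big1 ?addr0 // => j ji.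
  case: eqP => [|_]; last by rewrite mulr0.
  by rewrite -E => /enum_val_inj E'; rewrite E' eqxx in ji.
have conn u : connect g u x.
  apply/negPn/negP => ux.
  have /submxP[r rM] : ((delta_mx 0 (enum_rank u) : 'rV[R]_#|V|) <= M)%MS.
    by apply: submx_full; rewrite /row_full (eqP Minj) eV.
  have hr v : \sum_t wt r v t = (v == u)%:R.
    by rewrite wts -rM mxE eqxx (inj_eq enum_rank_inj).
  pose w s t := if connect g u s then wt r s t else 0.
  pose h := [rel s t | g s t && connect g u s].
  have w0 s t : w s t = 0.
    (* A cycle of [h] would share its edges with the odd cycle and hence pass through [x], outside
       the component of [u]. The only nonzero vertex sum is at [u], the exceptional vertex. *)
    apply: (@acyclic_kernel h u) s t.
    - by move=> s; rewrite /= gI.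
    - move=> y q c; have gq : is_cycle g y q.
        by apply: is_cycle_sub c => s t /andP[].
      have xq : x \in y :: q.
        case: p oC one => [[[]]//|z p] _ /(_ _ _ gq [set x; z]).
        rewrite mem_head => /cycle_edges_sub; apply; exact: set21.
      have [q' [[_ cq' _] _ _]] := cycle_rotate c xq.
      by move: cq'; case: q' => [|z q'] /= /andP[/andP[_ ux']]; rewrite ux' in ux.
    - move=> s t; rewrite /w; have [E|E] := eqVneq (wt r s t) 0.
        by rewrite (wtC r t s) E; do 2!case: ifP.
      have gst := wtg _ _ _ E; rewrite (wtC r t s).
      suff -> : connect g u s = connect g u t by [].
      by apply: same_connect_r; [apply: sym_connect_sym|apply: connect1].
    - move=> s t; rewrite /w /=; case: ifP => [us /wtg ->|_] //.
      by rewrite eqxx.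
    move=> v vu; rewrite /w; case: connect; last exact: big1.
    by rewrite hr (negPf vu).
  have := hr u; rewrite eqxx big1 => [/esym/eqP|t _]; first by rewrite oner_eq0.
  by have := w0 u t; rewrite /w connect0.
move=> u v; apply: connect_trans (conn u) _.
by rewrite (sym_connect_sym gS).
Qed.

End AlternatingSums.

(** * Arc vectors and the (-1)-eigenspace *)

(** Induction on [s]: the first functional [f] kills all later vectors, which form a basis of
    [W :&: lker f], while the first vector lies outside [lker f]. The hypothesis on common zeros
    gives spanning without a dimension count. *)
Lemma triangular_basis (F : fieldType) (vT : vectType F) (W : {vspace vT})
    (s : seq (vT * 'Hom(vT, F^o))) :
  all (fun t : vT * 'Hom(vT, F^o) => t.1 \in W) s -> all (fun t : vT * 'Hom(vT, F^o) => t.2 t.1 != 0) s ->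
  pairwise (fun t t' : vT * 'Hom(vT, F^o) => t.2 t'.1 == 0) s ->
  (forall w, w \in W -> all (fun t : vT * 'Hom(vT, F^o) => t.2 w == 0) s -> w = 0) ->
  basis_of W [seq t.1 | t <- s].
Proof.
elim: s W => [|[z f] s IH] W /=.
  move=> _ _ _ H; rewrite basisEdim /= span_nil leq0n andbT.
  by apply/subvP => w /H->; rewrite ?mem0v.
case/andP=> zW sW /andP[fz fs] /andP[sf pw] H.
have /andP[/eqP sp fr] : basis_of (W :&: lker f) [seq t.1 | t <- s].
  apply: IH => //.
    apply/allP => t ts; rewrite memv_cap memv_ker.
    by rewrite (allP sW) //= (allP sf).
  by move=> w; rewrite memv_cap memv_ker => /andP[wW fw] ws; apply: H; rewrite ?fw.
apply/andP; split.
  rewrite span_cons sp; apply/eqP/vspaceP => w; apply/memv_addP/idP => [|wW].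
    case=> u /vlineP[c ->] [v]; rewrite memv_cap => /andP[vW _] ->.
    by rewrite memvD ?memvZ.
  exists ((f w / f z) *: z); first by rewrite memvZ ?memv_line.
  exists (w - (f w / f z) *: z); last by rewrite addrC subrK.
  rewrite memv_cap memvB ?memvZ //= memv_ker linearB linearZ /=.
  by rewrite [_ *: _](mulfVK fz) subrr.
rewrite free_cons fr andbT sp memv_cap memv_ker; apply: contra fz.
by case/andP.
Qed.

Section ArcVectors.
Variables (R : realType) (V : finType) (X : rel V).
Implicit Types (z : arc_vec R X) (al be : graph_arc X) (w : V -> V -> R).
Implicit Types (x u v : V) (p : seq V) (S : {set V}).

(** One linear form serves both for out-sums at a vertex and for sums over the arcs of an edge. *)
Definition arc_sum (P : pred (graph_arc X)) (z : 'cV[R]_#|{: graph_arc X}|) : R^o :=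
  \sum_(al : graph_arc X | P al) z (enum_rank al) 0.

Lemma arc_sum_is_linear P : linear (arc_sum P).
Proof.
move=> c z z'; rewrite /arc_sum scaler_sumr -big_split /=.
by apply: eq_bigr => al _; rewrite !mxE.
Qed.

HB.instance Definition _ P :=
  GRing.isLinear.Build R 'cV[R]_#|{: graph_arc X}| R^o _ (arc_sum P)
    (arc_sum_is_linear P).

Definition arc_form P := linfun (arc_sum P).

Definition edge_constant z : Prop :=
  forall al be, arc_edge al = arc_edge be -> entry z al = entry z be.

(** Extension by zero to non-adjacent pairs: the sum has at most one term. It turns arc vectors into
    weightings of vertex pairs, to which the kernel lemmas apply. *)
Definition ext z u v : R := \sum_(al : graph_arc X | val al == (u, v)) entry z al.

Definition arc_vec_of w : arc_vec R X :=
  \col_i w (arc_tail (enum_val i)) (arc_head (enum_val i)).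

Lemma arc_of u v : X u v -> exists al : graph_arc X, arc_tail al = u /\ arc_head al = v.
Proof. by move=> Xuv; exists (exist (fun uv : V * V => X uv.1 uv.2) (u, v) Xuv). Qed.

Lemma arcP al : X (arc_tail al) (arc_head al).
Proof. exact: valP al. Qed.

Lemma arc_edge_edges al : arc_edge al \in edges X.
Proof. by apply/edgesP; exists (arc_tail al), (arc_head al); split=> //; apply: arcP. Qed.

Lemma arc_of_edge e : e \in edges X -> exists al, arc_edge al = e.
Proof.
case/edgesP=> u [v [/arc_of[al [tl hd]] ->]].
by exists al; rewrite /arc_edge tl hd.
Qed.

Lemma entry_arc_vec_of w al : entry (arc_vec_of w) al = w (arc_tail al) (arc_head al).
Proof. by rewrite /entry mxE enum_rankK. Qed.

Lemma out_sum_support z w v :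
  (forall al, entry z al = w (arc_tail al) (arc_head al)) ->
  (forall s t, w s t != 0 -> X s t) -> out_sum z v = \sum_u w v u.
Proof.
move=> zw wX; rewrite /out_sum (partition_big (@arc_head _ X) predT) //=.
apply: eq_bigr => u _; have [Xvu|Xvu] := boolP (X v u); last first.
  rewrite big_pred0 => [|al].
    by apply/esym/eqP; apply: contraR Xvu => /wX.
  by apply/negP => /andP[/eqP t /eqP h]; move: Xvu; rewrite -t -h arcP.
have [al [tl hd]] := arc_of Xvu.
rewrite (big_pred1 al) => [|be]; first by rewrite zw tl hd.
rewrite /= -tl -hd -val_eqE; case: al be {tl hd} => [[? ?] ?] [[? ?] ?] /=.
by rewrite /arc_tail /arc_head /= xpair_eqE.
Qed.

Lemma ext_arc z al : ext z (arc_tail al) (arc_head al) = entry z al.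
Proof. by rewrite /ext (big_pred1 al) // => be; rewrite -surjective_pairing. Qed.

Lemma ext_support z u v : ext z u v != 0 -> X u v.
Proof.
apply: contraR => Xuv; rewrite /ext big_pred0 // => al.
by apply/negP => /eqP E; move: (valP al) Xuv; rewrite /= E => ->.
Qed.

Lemma extC z u v : symmetric X -> edge_constant z -> ext z u v = ext z v u.
Proof.
move=> XS zc; have [Xuv|Xuv] := boolP (X u v); last first.
  transitivity (0 : R); first by apply: contraNeq Xuv => /ext_support.
  by apply/esym; apply: contraNeq Xuv => /ext_support; rewrite XS.
have [al [<- <-]] := arc_of Xuv.
have [|be [tl hd]] := @arc_of (arc_head al) (arc_tail al); first by rewrite XS arcP.
rewrite ext_arc -tl -hd ext_arc; apply: zc.
by rewrite /arc_edge tl hd setUC.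
Qed.

Lemma sum_ext z v : \sum_u ext z v u = out_sum z v.
Proof.
by apply/esym/out_sum_support => [al|]; [rewrite ext_arc|apply: ext_support].
Qed.

(** When the edges are distinct, the position of an edge is determined by the edge, so the
    positional sign is the value of [alt] up to a global sign. *)
Lemma alternatesP z m x p : uniq (walk_edges x p) ->
  alternates z m (walk_edges x p) <->
  exists eps : bool, forall al, arc_edge al \in walk_edges x p ->
    entry z al = (-1) ^+ eps * m * alt R x p (arc_tail al) (arc_head al).
Proof.
move=> up; split=> -[eps H]; exists eps.
  move=> al alp; have ip := alp; rewrite -index_mem in ip.
  have E : arc_edge al = nth set0 (walk_edges x p) (index (arc_edge al) (walk_edges x p)).
    by rewrite nth_index.
  rewrite (H _ _ ip E) (alt_nth _ up _ E) -1?(size_walk_edges x) //.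
  by rewrite exprD mulrAC.
move=> i al; rewrite size_walk_edges => ip E; rewrite H.
  by rewrite (alt_nth _ up ip E) exprD mulrAC.
by rewrite E mem_nth ?size_walk_edges.
Qed.

Lemma alternates_values z m s al : alternates z m s -> arc_edge al \in s ->
  entry z al = m \/ entry z al = - m.
Proof.
case=> eps H als; rewrite (H (index (arc_edge al) s)) ?index_mem ?nth_index //.
by rewrite -signr_odd; case: odd; [right|left]; rewrite ?mulN1r ?mul1r.
Qed.

Lemma alternates_const z m s al be : alternates z m s -> arc_edge al \in s ->
  arc_edge al = arc_edge be -> entry z al = entry z be.
Proof.
case=> eps H als E; rewrite !(H (index (arc_edge al) s)) ?index_mem ?nth_index //.
Qed.

Lemma along_walk_edge_constant z s :
  alternates z 1 s -> zero_off z s -> edge_constant z.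
Proof.
move=> zs z0 al be E; have [als|als] := boolP (arc_edge al \in s).
  exact: alternates_const zs als E.
by rewrite !z0 -?E.
Qed.

Lemma along_walk_exists x p : uniq (walk_edges x p) -> exists z : arc_vec R X,
  alternates z 1 (walk_edges x p) /\ zero_off z (walk_edges x p).
Proof.
move=> up; exists (arc_vec_of (alt R x p)); split; last first.
  by move=> al alp; rewrite entry_arc_vec_of alt_off.
apply/alternatesP => //; exists false => al _.
by rewrite entry_arc_vec_of !mul1r.
Qed.

Lemma along_walk_out_sum z x p : simple_graph X -> path X x p ->
  uniq (walk_edges x p) -> alternates z 1 (walk_edges x p) ->
  zero_off z (walk_edges x p) -> exists eps : bool, forall v,
  out_sum z v = (-1) ^+ eps * ((v == x)%:R - (-1) ^+ size p * (v == last x p)%:R).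
Proof.
move=> [XS XI] pp up /alternatesP-/(_ up)[eps H] z0; exists eps => v.
rewrite -(sum_alt R v XI pp) mulr_sumr; apply: (out_sum_support (w := fun s t => (-1) ^+ eps * alt R x p s t)) => [al|s t].
  have [/H->|alp] := boolP (arc_edge al \in walk_edges x p); first by rewrite mulr1.
  by rewrite z0 // alt_off ?mulr0.
by rewrite mulf_eq0 negb_or => /andP[_]; apply: (alt_support XS pp).
Qed.

Lemma even_cycle_out_sum z x p : simple_graph X -> even_cycle X x p ->
  alternates z 1 (cycle_edges x p) -> zero_off z (cycle_edges x p) ->
  forall v, out_sum z v = 0.
Proof.
move=> sX [[sp cp up] ep] zs z0 v.
have [eps ->] := along_walk_out_sum sX cp (uniq_cycle_edges sp up) zs z0.
by rewrite last_rcons size_rcons -(signr_odd _ (size p).+1) [odd _](negPf ep) mul1r subrr mulr0.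
Qed.

(** * The transition matrix entrywise and its (-1)-eigenspace *)

Lemma tail_mxE z v : (tail_mx R X *m z) (enum_rank v) 0 = out_sum z v.
Proof.
rewrite mxE (reindex (@enum_rank {: graph_arc X})) /=; last exact/onW_bij/enum_rank_bij.
rewrite /out_sum [RHS]big_mkcond; apply: eq_bigr => al _; rewrite mxE !enum_rankK eq_sym.
by case: eqP; rewrite ?mul1r ?mul0r.
Qed.

Lemma unmarked_mxE S (f : 'cV[R]_#|V|) v :
  (unmarked_mx R S *m f) (enum_rank v) 0 = if v \in S then 0 else f (enum_rank v) 0.
Proof.
rewrite mxE (bigD1 (enum_rank v)) //= big1 ?addr0 => [|i iv]; rewrite mxE !enum_rankK.
  by rewrite andbb eqxx; case: ifP; rewrite ?mul0r ?mul1r.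
by rewrite [_ == i]eq_sym (negPf iv) if_same mul0r.
Qed.

Lemma tail_mx_trE (f : 'cV[R]_#|V|) al :
  ((tail_mx R X)^T *m f) (enum_rank al) 0 = f (enum_rank (arc_tail al)) 0.
Proof.
rewrite mxE (bigD1 (enum_rank (arc_tail al))) //= big1 ?addr0 => [|i iv].
  by rewrite !mxE !enum_rankK eqxx mul1r.
rewrite !mxE enum_rankK; case: eqP => [E|_]; last by rewrite mul0r.
by rewrite -E enum_valK eqxx in iv.
Qed.

Lemma reversal_mxE z al be : arc_tail be = arc_head al -> arc_head be = arc_tail al ->
  (reversal_mx R X *m z) (enum_rank al) 0 = entry z be.
Proof.
move=> tl hd; rewrite mxE (bigD1 (enum_rank be)) //= big1 ?addr0 => [|i iv].
  by rewrite mxE !enum_rankK tl hd !eqxx mul1r.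
rewrite mxE enum_rankK; case: andP => [[/eqP h /eqP t]|_]; last by rewrite mul0r.
case/eqP: iv; rewrite -[i]enum_valK; congr enum_rank; apply: val_inj.
by rewrite /= [val (enum_val i)]surjective_pairing [val be]surjective_pairing;
   congr pair; rewrite -/(arc_tail _) -/(arc_head _) ?tl ?hd.
Qed.

Lemma transition_mxE k S z al be : arc_tail be = arc_head al -> arc_head be = arc_tail al ->
  (transition_mx R X k S *m z) (enum_rank al) 0 =
  2 / k%:R * (if arc_head al \in S then 0 else out_sum z (arc_head al)) - entry z be.
Proof.
move=> tl hd; rewrite -mulmxA (reversal_mxE _ tl hd) /entry mulmxBl mul1mx.
rewrite -scalemxAl -!mulmxA mxE [X in X + _]mxE [X in _ + X]mxE tail_mx_trE unmarked_mxE tail_mxE tl.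
by [].
Qed.

(* With f the out-sums of z off the marked vertices, the eigenvalue equation
   reads z(v,u) - z(u,v) = (2/k) f(v). Hence f changes sign along every arc,
   and f(a) = 0 forces f = 0 by connectedness. *)
Lemma mem_minus1_eigenspace k S a z :
  simple_graph X -> regular X k -> Defs.connected X -> a \in S ->
  reflect (edge_constant z /\ forall v, v \notin S -> out_sum z v = 0)
          (z \in mx_eigenspace (transition_mx R X k S) (-1)).
Proof.
move=> [XS XI] Xk Xc aS.
have rev al : exists be : graph_arc X, arc_tail be = arc_head al /\ arc_head be = arc_tail al.
  by apply: arc_of; rewrite XS arcP.
(* The factor [2 / k%:R] can be cancelled wherever there is an arc; for [k = 0] there are none. *)
have k0 u v : X u v -> k%:R != 0 :> R.
  move=> Xuv; rewrite pnatr_eq0 -(Xk u) -lt0n card_gt0; apply/set0Pn.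
  by exists v; rewrite inE.
pose f v := if v \in S then 0 else out_sum z v.
have memE : (z \in mx_eigenspace (transition_mx R X k S) (-1)) <->
    forall al be, arc_tail be = arc_head al -> arc_head be = arc_tail al ->
      2 / k%:R * f (arc_head al) - entry z be = - entry z al.
  rewrite memv_ker !lfun_simp /= scaleN1r opprK addr_eq0; split=> [/eqP E al be tl hd|H].
    by rewrite -(transition_mxE k S _ tl hd) E mxE.
  apply/eqP/colP => i; rewrite -[i]enum_valK; have [be [tl hd]] := rev (enum_val i).
  by rewrite (transition_mxE k S _ tl hd) -/(f _) H // mxE.
apply: (iffP idP) => [/memE E|[zc z0]]; last first.
  apply/memE => al be tl hd; rewrite (zc al be); last by rewrite /arc_edge tl hd setUC.
  rewrite /f; case: ifPn => [_|/z0 ->]; by rewrite mulr0 sub0r.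
have fN u v : X u v -> f v = - f u.
  move=> Xuv; have [al [tl hd]] := arc_of Xuv; have [be [tl' hd']] := rev al.
  (* Adding the equations of an arc and of its reverse eliminates the entries of [z]. *)
  have E1 := E _ _ tl' hd'; have := E be al (esym hd') (esym tl').
  rewrite -tl -hd hd' => E2.
  have k2 : 2 / k%:R != 0 :> R.
    by rewrite mulf_neq0 ?invr_eq0 ?(k0 _ _ Xuv) // pnatr_eq0.
  apply: (mulfI k2); apply/eqP; rewrite mulrN -subr_eq0 opprK; apply/eqP.
  by rewrite (canRL (subrK _) E1) (canRL (subrK _) E2) addrA addrK addNr.
have f0 v : f v = 0.
  have /connectP[p pp ->] := Xc a v.
  have : f a = 0 by rewrite /f aS.
  elim: p a pp {aS} => //= y p IH x /andP[xy pp] fx.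
  by apply: IH pp _; rewrite (fN _ _ xy) fx oppr0.
have E' al be : arc_tail be = arc_head al -> arc_head be = arc_tail al ->
    entry z be = entry z al.
  by move=> tl hd; have := E _ _ tl hd; rewrite f0 mulr0 sub0r => /oppr_inj.
split=> [al be /eqP/edge_eqP[[t h]|[t h]]|v vS]; last by have := f0 v; rewrite /f (negPf vS).
  congr entry; apply: val_inj.
  by rewrite /= [val al]surjective_pairing [val be]surjective_pairing; congr pair.
by apply/esym/E'.
Qed.

End ArcVectors.

(** * The basis vectors *)

Section Bases.
Variables (R : realType) (V : finType) (X : rel V).
Implicit Types (z : arc_vec R X) (al be : graph_arc X) (Y : rel V).
Implicit Types (e : {set V}) (x y u v : V) (p q : seq V) (S : {set V}).

Definition out_form v := arc_form R (fun al => arc_tail al == v).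
Definition edge_form e := arc_form R (fun al => arc_edge al == e).

Lemma out_formE v z : out_form v z = out_sum z v.
Proof. by rewrite lfunE. Qed.

(** The form is the common entry times the number of arcs on the edge, which is nonzero because [al]
    is one of them. *)
Lemma edge_form_eq0 z al : edge_constant z ->
  (edge_form (arc_edge al) z == 0) = (entry z al == 0).
Proof.
move=> zc; rewrite lfunE /= /arc_sum (eq_bigr (fun=> entry z al)); last first.
  by move=> be /eqP /zc.
rewrite sumr_const -mulr_natr mulf_eq0 pnatr_eq0 orbC.
case: eqP => // /card0_eq/(_ al).
by move/(etrans (esym (eqxx (arc_edge al)))).
Qed.

(** The properties of the vectors [z_e] on which both parts of the theorem rely, whether the support
    is one cycle or two joined odd cycles. *)
Definition coedge_vector Y e z : Prop :=
  [/\ edge_constant z, forall v, out_sum z v = 0,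
      forall al, arc_edge al = e -> entry z al != 0 &
      forall al, arc_edge al \notin edges Y -> arc_edge al != e -> entry z al = 0].

(** Common skeleton of both parts. The vertex vectors come first, detected by out-sums in the order
    of [L]; edge vectors have zero out-sums and are told apart by their values on the edges outside
    [Y]. Nothing is asked of the values of vertex vectors on these edges. *)
Lemma coedge_basis k S a Y (L : seq V) (ze : {set V} -> arc_vec R X)
    (zv : V -> arc_vec R X) :
  simple_graph X -> regular X k -> Defs.connected X -> a \in S ->
  (forall e, e \in edges X :\: edges Y -> coedge_vector Y e (ze e)) ->
  (forall v, v \in L -> edge_constant (zv v) /\
     forall u, u \notin S -> out_sum (zv v) u = 0) ->
  (forall v, v \in L -> out_sum (zv v) v != 0) ->
  pairwise (fun u v => out_sum (zv v) u == 0) L ->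
  (forall z, edge_constant z -> (forall v, v \notin S -> out_sum z v = 0) ->
     (forall v, v \in L -> out_sum z v = 0) ->
     (forall al, arc_edge al \notin edges Y -> entry z al = 0) ->
     forall al, entry z al = 0) ->
  basis_of (mx_eigenspace (transition_mx R X k S) (-1))
    ([seq ze e | e <- enum (edges X :\: edges Y)] ++ [seq zv v | v <- L]).
Proof.
move=> sX Xk Xc aS zeP zvS zv0 zvL ker.
have memW z := mem_minus1_eigenspace z sX Xk Xc aS.
set W := mx_eigenspace _ _ in memW *; set D := edges X :\: edges Y.
pose s := [seq (zv v, out_form v) | v <- L] ++ [seq (ze e, edge_form e) | e <- enum D].
have zeW e : e \in D -> ze e \in W.
  by move=> eD; have [? z0 _ _] := zeP e eD; apply/memW.
have zvW v : v \in L -> zv v \in W by move=> vL; apply/memW/zvS.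
rewrite (perm_basis (Y := [seq t.1 | t <- s])); last first.
  by rewrite perm_catC map_cat -!map_comp.
apply: triangular_basis.
- rewrite all_cat !all_map; apply/andP; split; apply/allP => t /=; first exact: zvW.
  by rewrite mem_enum; apply: zeW.
- rewrite all_cat !all_map; apply/andP; split; apply/allP => t /=.
    by move=> tL; rewrite out_formE zv0.
  rewrite mem_enum => tD; have [zc _ ne _] := zeP t tD.
  have /arc_of_edge[al E] : t \in edges X by move: tD; rewrite inE => /andP[].
  by rewrite -{1}E edge_form_eq0 // ne.
- rewrite pairwise_cat !pairwise_map; apply/and3P; split.
  + apply/allrelP => _ _ /mapP[v vL ->] /mapP[e + ->] /=; rewrite mem_enum => eD.
    by have [_ z0 _ _] := zeP e eD; rewrite out_formE z0.
  + apply: sub_pairwise zvL => u v /=; by rewrite out_formE.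
  have := enum_uniq D; rewrite uniq_pairwise; apply: (sub_in_pairwise (P := [in D])).
    move=> e f eD fD /= ef; have [zc _ _ z0] := zeP f fD.
    move: eD; rewrite inE => /andP[eY /arc_of_edge[al E]].
    by rewrite -E edge_form_eq0 // z0 ?E.
  by apply/allP => e; rewrite mem_enum.
move=> z /memW[zc zS]; rewrite all_cat !all_map => /andP[/allP zL /allP zD].
(* A common zero of all forms is supported on [Y] and has zero out-sums on [L], which is the
   situation of [ker]. *)
apply/colP => i; rewrite mxE -[i]enum_valK; apply: ker => // [v /zL|al alY] /=.
  by rewrite out_formE => /eqP.
apply/eqP; rewrite -edge_form_eq0 //; apply: (zD (arc_edge al)).
by rewrite mem_enum inE alY arc_edge_edges.
Qed.

Lemma add_edge_edges Y e f : f \in edges (add_edge Y e) -> f \in edges Y \/ f = e.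
Proof.
case/edgesP=> u [v [/orP[Yuv|/eqP E] ->]]; last by right.
by left; apply/edgesP; exists u, v.
Qed.

Lemma add_edge_sub Y e : symmetric X -> subrel Y X -> e \in edges X ->
  subrel (add_edge Y e) X.
Proof.
move=> XS YX eX u v /orP[/YX //|/eqP E].
by rewrite -(mem_edges _ _ XS) E.
Qed.

Lemma off_add_edge Y e al : arc_edge al \notin edges Y -> arc_edge al != e ->
  arc_edge al \notin edges (add_edge Y e).
Proof. by move=> alY /eqP ale; apply/negP => /add_edge_edges[H|//]; rewrite H in alY. Qed.

Lemma coedge_vector_even_cycle Y e z x p : simple_graph X -> subrel Y X ->
  e \in edges X -> even_cycle_through Y e x p ->
  alternates z 1 (cycle_edges x p) -> zero_off z (cycle_edges x p) ->
  coedge_vector Y e z.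
Proof.
move=> sX YX eX [ec ep] zs z0; have [XS _] := sX.
have ecX : even_cycle X x p.
  by case: ec => c ev; split=> //; apply: is_cycle_sub c; apply: add_edge_sub.
split; first exact: along_walk_edge_constant zs z0.
- exact: even_cycle_out_sum sX ecX zs z0.
- move=> al E; rewrite -E in ep.
  case: (alternates_values zs ep) => ->; by rewrite ?oppr_eq0 oner_eq0.
move=> al alY ale; apply: z0; apply/negP => alc.
case: ec => -[_ cp _] _; have := off_add_edge alY ale.
by rewrite (cycle_edges_edges cp alc).
Qed.

Lemma arc_ends_neq al : irreflexive X -> arc_tail al <> arc_head al.
Proof. by move=> XI E; have := arcP al; rewrite E XI. Qed.

(** An edge has two distinct ends, so vertex sets sharing at most one vertex share no edge. *)
Lemma meets_only_at_edge (s t : seq V) x al : irreflexive X -> meets_only_at s t x ->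
  (forall v, v \in arc_edge al -> v \in s) ->
  (forall v, v \in arc_edge al -> v \in t) -> False.
Proof.
move=> XI st As At; apply: (arc_ends_neq (al := al) XI).
rewrite (st (arc_tail al)); try by [apply: As; rewrite set21|apply: At; rewrite set21].
by rewrite (st (arc_head al)) //; [apply: As|apply: At]; rewrite set22.
Qed.

Lemma coedge_vector_joined Y e z : symmetric X ->
  along_joined_odd_cycles Y e z -> coedge_vector Y e z.
Proof.
move=> XS [x [p1 [y [p2 [q [J eC [zq z1 z2] z0 zs]]]]]].
split=> //.
- move=> al be E; have [|als] := boolP (arc_edge al \in walk_edges x q ++
      (cycle_edges x p1 ++ cycle_edges y p2)); last by rewrite !z0 -?E.
  by rewrite !mem_cat => /or3P[] H;
     [apply: alternates_const zq H E|apply: alternates_const z1 H E|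
      apply: alternates_const z2 H E].
- move=> al E; rewrite -E in eC.
  by case: eC => [/(alternates_values z1)|/(alternates_values z2)] [] ->;
     rewrite ?oppr_eq0 oner_eq0.
move=> al alY ale; apply: z0; have := off_add_edge alY ale; apply: contra.
case: J => -[[_ c1 _] _] [[_ c2 _] _] [pq _ _] _.
by rewrite !mem_cat => /or3P[/(walk_edges_path pq)|/(cycle_edges_edges c1)|
  /(cycle_edges_edges c2)].
Qed.

Lemma joined_exists Y e x p1 y p2 q : simple_graph X -> subrel Y X -> e \in edges X ->
  joined_odd_cycles (add_edge Y e) x p1 y p2 q -> e \in cycle_edges x p1 ->
  exists z : arc_vec R X, along_joined_odd_cycles Y e z.
Proof.
move=> [XS XI] YX eX J eC; have sub := add_edge_sub XS YX eX.
case: (J) => -[c1 o1] [c2 o2] [pq uq lq] [qx qy xy yx].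
have [sp1 cc1 up1] := is_cycle_sub sub c1; have [sp2 cc2 up2] := is_cycle_sub sub c2.
have pqX : path X x q by apply: sub_path pq.
(* The first cycle contributes 2 at [x]. The path cancels it and leaves [2 * (-1) ^+ size q] at [y],
   which the second cycle cancels. For an empty path the two cycles cancel directly. *)
pose w u v := alt R x (rcons p1 x) u v - 2 * alt R x q u v
   - (-1) ^+ size q * alt R y (rcons p2 y) u v.
have eq_q v al : arc_edge al \in walk_edges x q -> v \in arc_edge al -> v \in x :: q.
  exact: walk_edges_sub.
have eq_1 v al : arc_edge al \in cycle_edges x p1 -> v \in arc_edge al -> v \in x :: p1.
  exact: cycle_edges_sub.
have eq_2 v al : arc_edge al \in cycle_edges y p2 -> v \in arc_edge al -> v \in y :: p2.
  exact: cycle_edges_sub.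
have dq1 al : arc_edge al \in walk_edges x q -> arc_edge al \notin cycle_edges x p1.
  move=> alq; apply/negP => al1.
  apply: (meets_only_at_edge XI qx) => v; [exact: eq_q _ _ alq|exact: eq_1 _ _ al1].
have dq2 al : arc_edge al \in walk_edges x q -> arc_edge al \notin cycle_edges y p2.
  move=> alq; apply/negP => al2.
  apply: (meets_only_at_edge XI qy) => v; [exact: eq_q _ _ alq|exact: eq_2 _ _ al2].
have d12 al : arc_edge al \in cycle_edges x p1 -> arc_edge al \notin cycle_edges y p2.
  move=> al1; apply/negP => al2.
  apply: (meets_only_at_edge XI xy) => v; [exact: eq_1 _ _ al1|exact: eq_2 _ _ al2].
exists (arc_vec_of X w), x, p1, y, p2, q; split=> //; [by left|split|idtac|idtac].
- apply/alternatesP; first exact: uniq_walk_edges.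
  exists true => al alq; rewrite entry_arc_vec_of /w.
  rewrite [alt R x (rcons _ _) _ _]alt_off; last exact: dq1.
  rewrite [alt R y (rcons _ _) _ _]alt_off; last exact: dq2.
  by rewrite mulr0 subr0 sub0r mulN1r mulNr.
- apply/alternatesP; first exact: uniq_cycle_edges.
  exists false => al al1; rewrite entry_arc_vec_of /w.
  rewrite [alt R x q _ _]alt_off; last by apply/negP => /dq1; rewrite al1.
  rewrite [alt R y (rcons _ _) _ _]alt_off; last exact: d12.
  by rewrite !mulr0 !subr0 !mul1r.
- apply/alternatesP; first exact: uniq_cycle_edges.
  exists (~~ odd (size q)) => al al2; rewrite entry_arc_vec_of /w.
  rewrite [alt R x q _ _]alt_off; last by apply/negP => /dq2; rewrite al2.
  rewrite [alt R x (rcons _ _) _ _]alt_off; last by apply/negP => /d12; rewrite al2.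
  by rewrite mulr0 subr0 sub0r signrN signr_odd mulr1 mulNr.
- move=> al; rewrite !mem_cat !negb_or => /and3P[nq n1 n2].
  rewrite entry_arc_vec_of /w !alt_off //.
  by rewrite !mulr0 !subr0.
move=> v; rewrite (out_sum_support (w := w)) => [|al|s t]; last first.
- apply: contraR => nX.
  have K x' p' : path X x' p' -> alt R x' p' s t = 0.
    by move=> pp; apply: contraNeq nX; apply: alt_support.
  by rewrite /w !K // !mulr0 !subr0.
- exact: entry_arc_vec_of.
rewrite !sumrB -!mulr_sumr (sum_alt R v XI cc1) (sum_alt R v XI cc2) (sum_alt R v XI pqX).
rewrite !last_rcons lq !size_rcons -(signr_odd _ (size p1).+1) -(signr_odd _ (size p2).+1).
rewrite [odd _](o1 : odd (size p1).+1) [odd (size p2).+1](o2 : odd (size p2).+1).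
by ring.
Qed.

Lemma along_path_vector z a b : simple_graph X -> a != b -> along_path z a b ->
  [/\ edge_constant z, forall u, u != a -> u != b -> out_sum z u = 0,
      out_sum z b != 0 & forall al, entry z al \in [:: 0; 1; -1]].
Proof.
move=> sX ab [p [[pp up lp] zs z0]]; have ue := uniq_walk_edges up.
have [eps zout] := along_walk_out_sum sX pp ue zs z0; rewrite lp in zout.
split; first exact: along_walk_edge_constant zs z0.
- by move=> u ua ub; rewrite zout (negPf ua) (negPf ub) !mulr0 subrr mulr0.
- by rewrite zout eqxx [b == a]eq_sym (negPf ab) sub0r mulr1 mulrN oppr_eq0 mulf_neq0 ?signr_eq0.
move=> al; rewrite !inE; have [als|/z0->] := boolP (arc_edge al \in walk_edges a p).
  by case: (alternates_values zs als) => ->; rewrite eqxx ?orbT.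
by rewrite eqxx.
Qed.

Lemma along_path_exists a b : Defs.connected X -> exists z : arc_vec R X, along_path z a b.
Proof.
move=> Xc; have [p pab] := connect_is_path (Xc a b).
have [_ up _] := pab.
have [z [zs z0]] := along_walk_exists R X (uniq_walk_edges up).
by exists z, p.
Qed.

Lemma path_to_odd_cycle_vector Y a z : simple_graph X -> subrel Y X ->
  along_path_to_odd_cycle Y a z ->
  [/\ edge_constant z, forall u, u != a -> out_sum z u = 0,
      out_sum z a != 0 & forall al, entry z al \in [:: 0; 1; -1; 2; -2]].
Proof.
move=> [XS XI] YX [q [y [p [[[pq uq lq] oC] qy [zq zp] z0 zs]]]].
have [[sp cp up] op] := oC; have ue := uniq_walk_edges uq.
have uc := uniq_cycle_edges sp up.
have cX : cycle X (y :: p) by case: (is_cycle_sub YX oC.1).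
have dis al : arc_edge al \in walk_edges a q -> arc_edge al \notin cycle_edges y p.
  move=> alq; apply/negP => alp; apply: (meets_only_at_edge XI qy) => v.
    exact: walk_edges_sub alq.
  exact: cycle_edges_sub alp.
split=> //.
- move=> al be E; have [|als] := boolP (arc_edge al \in walk_edges a q ++ cycle_edges y p);
    last by rewrite !z0 -?E.
  rewrite mem_cat => /orP[] H; first exact: alternates_const zq H E.
  exact: alternates_const zp H E.
(* The out-sum at [a] is not prescribed and has to be computed: it is 2 up to sign, coming from the
   cycle if [a] lies on it and from the path otherwise. *)
- have [/(_ zq) [e1 H1] _] := alternatesP z 2 ue.
  have [/(_ zp) [e2 H2] _] := alternatesP z 1 uc.
  pose w u v := (-1) ^+ e1 * 2 * alt R a q u v + (-1) ^+ e2 * 1 * alt R y (rcons p y) u v.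
  rewrite (out_sum_support (w := w)) => [|al|s t]; last first.
  + apply: contraR => nX.
    have K x' p' : path X x' p' -> alt R x' p' s t = 0.
      by move=> pp; apply: contraNeq nX; apply: alt_support.
    by rewrite /w !K // !mulr0 addr0.
  + rewrite /w; have [alq|alq] := boolP (arc_edge al \in walk_edges a q).
      by rewrite H1 // [alt R y _ _ _]alt_off ?mulr0 ?addr0 //; apply: dis.
    rewrite [alt R a _ _ _]alt_off // mulr0 add0r.
    have [alp|alp] := boolP (arc_edge al \in cycle_edges y p); first by rewrite H2.
    by rewrite z0 ?mem_cat ?negb_or ?alq // alt_off ?mulr0.
  rewrite big_split -!mulr_sumr /= (sum_alt R a XI pq) (sum_alt R a XI cX).
  rewrite last_rcons lq size_rcons -(signr_odd _ (size p).+1) [odd _](op : odd (size p).+1).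
  rewrite eqxx; have [E|_] := eqVneq a y.
    have -> : q = [::] by apply: (is_path_nil (g := X) (x := a)); split=> //; rewrite lq.
    rewrite mul1r subrr mulr0 add0r mulr1 mulN1r opprK mulf_neq0 ?signr_eq0 //.
    by rewrite -(natrD _ 1 1) pnatr_eq0.
  by rewrite !mulr0 !subr0 mulr0 addr0 !mulr1 mulf_neq0 ?signr_eq0 ?pnatr_eq0.
move=> al; rewrite !inE; have [|/z0->] := boolP (arc_edge al \in walk_edges a q ++ cycle_edges y p);
  last by rewrite eqxx.
rewrite mem_cat => /orP[/(alternates_values zq)|/(alternates_values zp)] [] ->;
by rewrite eqxx ?orbT.
Qed.

Lemma path_to_odd_cycle_exists Y a x p : simple_graph X -> Defs.connected X ->
  subrel Y X -> odd_cycle Y x p -> exists z : arc_vec R X, along_path_to_odd_cycle Y a z.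
Proof.
move=> [XS XI] Xc YX [cY oY].
have [_ [y [q [/eqP-> yC [pq uq lq] _ qB]]]] := is_path_between (A := pred1 a)
     (B := [in x :: p]) (Xc a x) (eqxx a) (mem_head _ _).
have [r [cr perm _]] := cycle_rotate cY yC.
have [sr cc ur] := is_cycle_sub YX cr.
have qy : meets_only_at (a :: q) (y :: r) y.
  by move=> v vq; rewrite -(perm_mem perm); apply: qB.
have or : odd (size (y :: r)) by rewrite -(perm_size perm).
(* The path leaves [- 2 * (-1) ^+ size q] at its end [y]; the sign of the odd cycle is chosen to
   cancel it. *)
pose w u v := 2 * alt R a q u v + (-1) ^+ size q * alt R y (rcons r y) u v.
have dis al : arc_edge al \in walk_edges a q -> arc_edge al \notin cycle_edges y r.
  move=> alq; apply/negP => alp; apply: (meets_only_at_edge XI qy) => v.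
    exact: walk_edges_sub alq.
  exact: cycle_edges_sub alp.
exists (arc_vec_of X w), q, y, r; split=> //; first split.
- apply/alternatesP; first exact: uniq_walk_edges.
  exists false => al alq; rewrite entry_arc_vec_of /w.
  by rewrite [alt R y _ _ _]alt_off ?mulr0 ?addr0 ?mul1r //; apply: dis.
- apply/alternatesP; first exact: uniq_cycle_edges.
  exists (odd (size q)) => al alp; rewrite entry_arc_vec_of /w.
  rewrite [alt R a _ _ _]alt_off; last by apply/negP => /dis; rewrite alp.
  by rewrite mulr0 add0r signr_odd mulr1.
- move=> al; rewrite mem_cat negb_or => /andP[nq np].
  by rewrite entry_arc_vec_of /w !alt_off // !mulr0 addr0.
move=> v va; rewrite (out_sum_support (w := w)) => [|al|s t]; last first.
- apply: contraR => nX.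
  have K x' p' : path X x' p' -> alt R x' p' s t = 0.
    by move=> pp; apply: contraNeq nX; apply: alt_support.
  by rewrite /w !K // !mulr0 addr0.
- exact: entry_arc_vec_of.
rewrite big_split -!mulr_sumr /= (sum_alt R v XI pq) (sum_alt R v XI cc).
rewrite last_rcons lq size_rcons -(signr_odd _ (size r).+1) [odd _](or : odd (size r).+1).
rewrite (negPf va) /= mulr0n expr1. by ring.
Qed.

Lemma ext_support_off Y z : symmetric Y ->
  (forall al, arc_edge al \notin edges Y -> entry z al = 0) ->
  forall u v, ext z u v != 0 -> Y u v.
Proof.
move=> YS z0 u v zuv; have [al [tl hd]] := arc_of (ext_support zuv).
rewrite -(mem_edges _ _ YS); apply: contraR zuv => nY.
by rewrite -tl -hd ext_arc z0 // /arc_edge tl hd.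
Qed.

End Bases.

(** * Assembly of the bipartite and the non-bipartite basis *)

Theorem theorem3p4 (R : realType) (V : finType) (X : rel V) (k : nat)
    (S : {set V}) (a : V) :
  simple_graph X -> regular X k -> connected X -> a \in S ->
  (bipartite X ->
   forall T : rel V, spanning_tree T X ->
   [/\ forall e, e \in edges X :\: edges T ->
         exists z : arc_vec R X, along_fundamental_cycle T e z,
       forall b, b \in S :\ a -> exists z : arc_vec R X, along_path z a b &
       forall (ze : {set V} -> arc_vec R X) (zb : V -> arc_vec R X),
         (forall e, e \in edges X :\: edges T ->
            along_fundamental_cycle T e (ze e)) ->
         (forall b, b \in S :\ a -> along_path (zb b) a b) ->
         basis_with_entries [:: 0; 1; -1]
           (mx_eigenspace (transition_mx R X k S) (-1))
           ([seq ze e | e <- enum (edges X :\: edges T)] ++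
            [seq zb b | b <- enum (S :\ a)])]) /\
  (~ bipartite X ->
   forall Y : rel V, odd_unicyclic Y X ->
   [/\ forall e, e \in edges X :\: edges Y ->
         exists z : arc_vec R X, nonbip_edge_vec Y e z,
       forall b, b \in S :\ a -> exists z : arc_vec R X, along_path z a b,
       exists z : arc_vec R X, along_path_to_odd_cycle Y a z &
       forall (ze : {set V} -> arc_vec R X) (zb : V -> arc_vec R X)
              (za : arc_vec R X),
         (forall e, e \in edges X :\: edges Y -> nonbip_edge_vec Y e (ze e)) ->
         (forall b, b \in S :\ a -> along_path (zb b) a b) ->
         along_path_to_odd_cycle Y a za ->
         basis_with_entries [:: 0; 1; -1; 2; -2]
           (mx_eigenspace (transition_mx R X k S) (-1))
           ([seq ze e | e <- enum (edges X :\: edges Y)] ++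
            [seq zb b | b <- enum (S :\ a)] ++ [:: za])]).
Proof.
move=> sX Xk Xc aS; have [XS XI] := sX.
have bP b : b \in S :\ a -> a != b /\ b \in S.
  by rewrite !inE eq_sym => /andP[].
have zbP (zb : V -> arc_vec R X) : (forall b, b \in S :\ a -> along_path (zb b) a b) ->
    forall b, b \in S :\ a ->
    [/\ edge_constant (zb b), forall u, u != a -> u != b -> out_sum (zb b) u = 0,
        out_sum (zb b) b != 0 & forall al, entry (zb b) al \in [:: 0; 1; -1]].
  by move=> H b bS; apply: along_path_vector (H b bS) => //; case: (bP b bS).
have zbS (zb : V -> arc_vec R X) : (forall b, b \in S :\ a -> along_path (zb b) a b) ->
    forall b, b \in S :\ a -> forall u, u \notin S -> out_sum (zb b) u = 0.
  move=> /zbP H b bS u uS; have [_ H0 _ _] := H b bS; apply: H0.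
    by apply: contraNneq uS => ->.
  by apply: contraNneq uS => ->; case: (bP b bS).
have zbL (zb : V -> arc_vec R X) : (forall b, b \in S :\ a -> along_path (zb b) a b) ->
    pairwise (fun u v => out_sum (zb v) u == 0) (enum (S :\ a)).
  move=> /zbP H; have := enum_uniq (S :\ a); rewrite uniq_pairwise.
  apply: (sub_in_pairwise (P := [in S :\ a])); last by apply/allP => b; rewrite mem_enum.
  move=> u v uS vS /= uv; have [_ H0 _ _] := H v vS.
  by rewrite H0 // eq_sym; case: (bP u uS).
split=> [Xb T [[TS TX] Tc Tac]|_ Y [[YS YX] Yn [x [p [oC one]]]]].
  have even e x p : e \in edges X -> is_cycle (add_edge T e) x p ->
      even_cycle (add_edge T e) x p.
    move=> eX c; split=> //; apply: (bipartite_cycle_even Xb).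
    exact: is_cycle_sub (add_edge_sub XS TX eX) c.
  split=> [e|b _|ze zb zeP zbA]; last 1 first.
  - split.
      apply: (coedge_basis (a := a)) => //.
      + move=> e eD; have [x [p [c ec zs z0]]] := zeP e eD.
        have eX : e \in edges X by move: eD; rewrite inE => /andP[].
        apply: coedge_vector_even_cycle zs z0 => //.
        by split=> //; apply: even.
      + move=> v; rewrite mem_enum => vS; have [? _ _ _] := zbP zb zbA v vS.
        by split=> //; apply: zbS.
      + by move=> v; rewrite mem_enum => vS; have [] := zbP zb zbA v vS.
      + exact: zbL.
      move=> z zc zS zL zY al; rewrite -ext_arc.
      (* No form controls the out-sum at [a], which is therefore the exceptional vertex. *)
      apply: (@acyclic_kernel _ _ T a) => //.
      + by move=> u; apply/negP => /TX; rewrite XI.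
      + by move=> u v; apply: extC.
      + exact: ext_support_off.
      move=> v va; rewrite sum_ext; have [vS|/zS //] := boolP (v \in S).
      by apply: zL; rewrite mem_enum !inE va.
    move=> z; rewrite mem_cat => /orP[/mapP[e + ->] al|/mapP[b + ->] al];
      rewrite mem_enum => eD; last by have [] := zbP zb zbA b eD.
    have [x [p [_ _ zs z0]]] := zeP e eD; rewrite !inE.
    have [als|/z0->] := boolP (arc_edge al \in cycle_edges x p); last by rewrite eqxx.
    by case: (alternates_values zs als) => ->; rewrite eqxx ?orbT.
  - rewrite inE => /andP[eT /edgesP[u [v [Xuv E]]]].
    have uv : u != v by apply: contraTneq Xuv => ->; rewrite XI.
    have Tuv : ~~ T u v by rewrite -(mem_edges _ _ TS) -E.
    have [p tp] := connect_is_path (Tc u v).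
    have [c ec] := close_cycle TS tp uv Tuv; rewrite -E in c ec.
    have [sp _ up] := c.
    have [z [zs z0]] := along_walk_exists R X (uniq_cycle_edges sp up).
    by exists z, u, p.
  exact: along_path_exists.
have YI : irreflexive Y by move=> u; apply/negP => /YX; rewrite XI.
have Yc := odd_unicyclic_connected R YI YS Yn oC one.
have DP e : e \in edges X :\: edges Y -> exists u v,
    [/\ e = [set u; v], e \in edges X, u != v & ~~ Y u v].
  rewrite inE => /andP[eY eX]; have /edgesP[u [v [Xuv E]]] := eX.
  exists u, v; split=> //; first by apply: contraTneq Xuv => ->; rewrite XI.
  by rewrite -(mem_edges _ _ YS) -E.
have zeC (e : {set V}) (z : arc_vec R X) : nonbip_edge_vec Y e z ->
    along_even_cycle Y e z \/ along_joined_odd_cycles Y e z.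
  move=> [H1 H2]; have [/H1|/H2] := EM (exists x p, even_cycle_through Y e x p).
    by left.
  by right.
split=> [e eD|b _||ze zb za zeP zbA zaA].
- have [u [v [E eX uv Yuv]]] := DP e eD.
  have [[y [r ec]]|noE] := EM (exists x p, even_cycle_through Y e x p).
    have [[[sp _ up] _] _] := ec.
    have [z [zs z0]] := along_walk_exists R X (uniq_cycle_edges sp up).
    (* With an even cycle at hand the second half of [nonbip_edge_vec] is vacuous. *)
    by exists z; split=> [_|[]]; exists y, r.
  rewrite E in noE.
  have [x' [p1 [y [p2 [q [J eC]]]]]] := joined_odd_cycles_through YS YI Yc oC uv Yuv noE.
  rewrite -E in J eC noE.
  have [z zJ] := joined_exists R sX YX eX J eC.
  by exists z; split=> [/noE|].
- exact: along_path_exists.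
- exact: path_to_odd_cycle_exists sX Xc YX oC.
have [zac za0 zaa zav] := path_to_odd_cycle_vector sX YX zaA.
pose zv v := if v == a then za else zb v.
have zvb b : b \in S :\ a -> zv b = zb b.
  by case/bP; rewrite /zv eq_sym => /negPf->.
have zva : zv a = za by rewrite /zv eqxx.
(* The vertex [a] comes last: [za] has zero out-sum at every [b], whereas [zb b] has a nonzero one
   at [a]. *)
have EL : [seq zb b | b <- enum (S :\ a)] ++ [:: za] = [seq zv v | v <- rcons (enum (S :\ a)) a].
  rewrite map_rcons zva -cats1; congr (_ ++ _); apply/eq_in_map => b.
  by rewrite mem_enum => /zvb.
split.
  rewrite EL; apply: (coedge_basis (a := a)) => //.
  - move=> e eD; have [u [v [E eX uv Yuv]]] := DP e eD.
    case: (zeC _ _ (zeP e eD)) => [[y [r [ec zs z0]]]|J].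
      exact: coedge_vector_even_cycle ec zs z0.
    exact: coedge_vector_joined J.
  - move=> v; rewrite mem_rcons inE mem_enum => /predU1P[->|vS].
      by rewrite zva; split=> // u uS; apply: za0; apply: contraNneq uS => ->.
    rewrite zvb //; have [? _ _ _] := zbP zb zbA v vS.
    by split=> //; apply: zbS.
  - move=> v; rewrite mem_rcons inE mem_enum => /predU1P[->|vS]; first by rewrite zva.
    by rewrite zvb //; have [] := zbP zb zbA v vS.
  - rewrite pairwise_rcons; apply/andP; split.
      apply/allP => u; rewrite mem_enum zva => /bP[au _]; rewrite za0 //.
      by rewrite eq_sym.
    have := zbL zb zbA; apply: (sub_in_pairwise (P := [in S :\ a])).
      by move=> u v uS vS; rewrite zvb.
    by apply/allP => b; rewrite mem_enum.
  move=> z zc zS zL zY al; rewrite -ext_arc.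
  (* Now [a] belongs to the list of detecting vertices, so all out-sums vanish and no exceptional
     vertex remains. *)
  apply: (odd_unicyclic_kernel YI YS oC one) => //.
  - by move=> u v; apply: extC.
  - exact: ext_support_off.
  move=> v; rewrite sum_ext; have [vS|/zS //] := boolP (v \in S).
  by apply: zL; rewrite mem_rcons inE mem_enum !inE vS andbT orbN.
move=> z; rewrite !mem_cat mem_seq1 => /or3P[/mapP[e + ->] al|/mapP[b + ->] al|/eqP-> //];
  rewrite mem_enum => eD; last first.
  have [_ _ _ /(_ al)] := zbP zb zbA b eD.
  by rewrite !inE => /or3P[] ->; rewrite ?orbT.
rewrite !inE; case: (zeC _ _ (zeP e eD)) => [[y [r [_ zs z0]]]|].
  have [als|/z0->] := boolP (arc_edge al \in cycle_edges y r); last by rewrite eqxx.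
  by case: (alternates_values zs als) => ->; rewrite eqxx ?orbT.
case=> [x' [p1 [y [p2 [q [_ _ [zq z1 z2] z0 _]]]]]].
have [|/z0->] := boolP (arc_edge al \in walk_edges x' q ++ cycle_edges x' p1 ++ cycle_edges y p2);
  last by rewrite eqxx.
rewrite !mem_cat => /or3P[/(alternates_values zq)|/(alternates_values z1)|
  /(alternates_values z2)] [] ->; by rewrite eqxx ?orbT.
Qed.
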